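(* Let $D \subset \mathbb{R}^p$ be a bounded and measurable set, let $f, g : D \to \mathbb{R}$ be bounded, positive and measurable on $D$, and let $(\phi_n)_{n\ge1}$ and $(\psi_m)_{m\ge1}$ be two sequences of bounded, measurable functions $D \to \mathbb{R}$ that are mutually orthogonal on $D$ with respect to $\frac1f$ and $\frac1g$, respectively, with $0<\int_D \frac{\phi_n^2}{f}\,d\mu<\infty$ and $0<\int_D \frac{\psi_m^2}{g}\,d\mu<\infty$ for all $n,m$. Suppose that $f$ and $g$ have Fourier expansions $f = \sum_{n=1}^{\infty} c_n\phi_n$ and $g = \sum_{m=1}^{\infty} d_m\psi_m$, where $$c_n := \frac{\int_D \phi_n\,d\mu}{\int_D \frac{\phi_n^2}{f}\,d\mu}, \qquad d_m := \frac{\int_D \psi_m\,d\mu}{\int_D \frac{\psi_m^2}{g}\,d\mu}$$ for all positive integers $m,n$. Further suppose that for all positive integers $m,n$: $$\int_D \frac{\phi_n^2\psi_m^2}{fg}\,d\mu \;\le\; \int_D \frac{\phi_n^2}{f}\,d\mu \int_D \frac{\psi_m^2}{g}\,d\mu$$ and $$c_n d_m \int_D \phi_n\psi_m\,d\mu \;\ge\; c_n d_m \int_D \phi_n\,d\mu \int_D \psi_m\,d\mu.$$ Then $$\int_D fg\,d\mu \;\ge\; \int_D f\,d\mu \int_D g\,d\mu.$$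
   Context: $\mu$ is Lebesgue measure on $\mathbb{R}^p$; measurability and integrals are in the sense of Lebesgue. For a positive function $w$ on $D$, functions $(\phi_n)$ are mutually orthogonal on $D$ with respect to $\frac1w$ if $\int_D \phi_i \phi_j \cdot \frac{1}{w}\,d\mu = 0$ for all $i \ne j$. The Fourier expansions are understood in the mean-square sense: $\int_D \left(f-\sum_{n=1}^N c_n\phi_n\right)^2\frac{1}{f}\,d\mu \to 0$ and $\int_D \left(g-\sum_{m=1}^N d_m\psi_m\right)^2\frac{1}{g}\,d\mu \to 0$ as $N\to\infty$. *)

(* Defs.v *)
From HB Require Import structures.
From mathcomp Require Export all_boot all_order all_algebra.
From mathcomp Require Export all_classical all_reals all_analysis.

Set Implicit Arguments.
Unset Strict Implicit.
Unset Printing Implicit Defensive.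

Import Order.TTheory GRing.Theory Num.Theory.
Import numFieldNormedType.Exports.

Local Open Scope classical_set_scope.
Local Open Scope ring_scope.

Section box.
Context {R : realType} {p : nat}.
Implicit Types a b : 'rV[R]_p.

Definition box a b : set 'rV[R]_p :=
  [set x | forall i, a ord0 i < x ord0 i <= b ord0 i].

Definition box_volume a b : R := \prod_(i < p) Num.max 0 (b ord0 i - a ord0 i).

Lemma box_volume_ge0 a b : (0 <= (box_volume a b)%:E)%E.
Proof. by rewrite lee_fin; apply: prodr_ge0 => i _; rewrite le_max lexx. Qed.

End box.

Section lebesgue_outer_measure.
Context (R : realType) (p : nat).
Local Open Scope ereal_scope.

(* The index set K is arbitrary, so that finite and empty covers are allowed;
   this only makes a difference for p = 0, where every box has volume 1. *)
Definition lebesgue_outer (A : set 'rV[R]_p) : \bar R :=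
  ereal_inf [set s | exists (K : set nat) (a b : nat -> 'rV[R]_p),
    A `<=` \bigcup_(k in K) box (a k) (b k) /\
    s = \esum_(k in K) (box_volume (a k) (b k))%:E].

Let ge0 A : 0 <= lebesgue_outer A.
Proof.
apply: le_ereal_inf_tmp => _ [K [a [b [_ ->]]]].
by apply: esum_ge0 => k _; exact: box_volume_ge0.
Qed.

Let outer0 : lebesgue_outer set0 = 0.
Proof.
apply/eqP; rewrite eq_le ge0 andbT; apply: ereal_inf_lbound.
by exists set0, (fun=> 0%R), (fun=> 0%R); split => //; rewrite esum_set0.
Qed.

Let homo : {homo lebesgue_outer : A B / A `<=` B >-> A <= B}.
Proof.
move=> A B AB; apply: ereal_inf_le_tmp => _ [K [a [b [BK ->]]]].
by exists K, a, b; split => //; exact: subset_trans BK.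
Qed.

Let sigma_sub : sigma_subadditive lebesgue_outer.
Proof.
move=> A; have [[i ioo]|] := pselect (exists i, lebesgue_outer (A i) = +oo).
  rewrite (eseries_pinfty _ _ ioo) ?leey// => n _.
  by rewrite -ltNye (lt_le_trans _ (ge0 _)).
rewrite -forallNE => Aoo.
suff add2e (e : {posnum R}) : lebesgue_outer (\bigcup_n A n) <=
    \sum_(i <oo) lebesgue_outer (A i) + e%:num%:E.
  by apply/lee_addgt0Pr => _/posnumP[].
rewrite (le_trans _ (epsilon_trick _ _ _))//.
pose P n (t : set nat * (nat -> 'rV[R]_p) * (nat -> 'rV[R]_p)) :=
  A n `<=` \bigcup_(k in t.1.1) box (t.1.2 k) (t.2 k) /\
  \esum_(k in t.1.1) (box_volume (t.1.2 k) (t.2 k))%:E <=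
    lebesgue_outer (A n) + (e%:num / (2 ^ n.+1)%:R)%:E.
have [G PG] : {G & forall n, P n (G n)}.
  apply: (@choice _ _ P) => n.
  have en1 : (0 < e%:num / (2 ^ n.+1)%:R :> R)%R by [].
  have fA : lebesgue_outer (A n) \is a fin_num.
    by rewrite ge0_fin_numE// ltey; apply/eqP; exact: Aoo.
  have [_ [K [a [b [AK ->]]]] /ltW lt] := lb_ereal_inf_adherent en1 fA.
  by exists (K, a, b).
have /card_esym/ppcard_eqP[f] := card_nat2.
pose K := [set n | (G (f n).1).1.1 (f n).2].
pose a n := (G (f n).1).1.2 (f n).2.
pose b n := (G (f n).1).2 (f n).2.
have vol_ge0 : forall n k,
    0 <= (box_volume ((G n).1.2 k) ((G n).2 k))%:E.
  by move=> n k; exact: box_volume_ge0.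
apply: (@le_trans _ _ (\esum_(k in K) (box_volume (a k) (b k))%:E)).
  apply: ereal_inf_lbound; exists K, a, b; split => // x [n _].
  move=> /(PG n).1[k Kk xk]; exists (f^-1%FUN (n, k)).
    by rewrite /K /= invK ?inE.
  by rewrite /a /b invK ?inE.
rewrite [leLHS](_ : _ = \esum_(i in setT) \esum_(k in (G i).1.1)
    (box_volume ((G i).1.2 k) ((G i).2 k))%:E); last first.
  rewrite esum_esum//.
  rewrite (reindex_esum K _ f)//; split=> [n Kn|m n _ _ mn|[n k] [_ /= Gk]].
  - by split.
  - by apply: (@inj _ _ _ f); rewrite ?inE.
  - by exists (f^-1%FUN (n, k)); rewrite /K /= ?invK ?inE.
rewrite nneseries_esumT; last by move=> n; rewrite adde_ge0.
by apply: le_esum => n _; exact: (PG n).2.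
Qed.

HB.instance Definition _ := isOuterMeasure.Build R 'rV[R]_p lebesgue_outer
  outer0 ge0 homo sigma_sub.

(* 'rV[R]_p equipped with the Lebesgue sigma-algebra, i.e. the sets that are
   Caratheodory measurable for the Lebesgue outer measure *)
Definition lebesgueType : Type := caratheodory_type lebesgue_outer.

HB.instance Definition _ := Measurable.copy lebesgueType
  (caratheodory_type lebesgue_outer).

Definition lebesgue_rV : set lebesgueType -> \bar R := lebesgue_outer.

HB.instance Definition _ := isMeasure.Build _ lebesgueType R lebesgue_rV
  (@caratheodory_measure0 R 'rV[R]_p lebesgue_outer)
  (@caratheodory_measure_ge0 R 'rV[R]_p lebesgue_outer)
  (@caratheodory_measure_sigma_additive R 'rV[R]_p lebesgue_outer).

End lebesgue_outer_measure.
Arguments lebesgue_rV {R p}.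

Section fourier.
Context (d : measure_display) (T : measurableType d) (R : realType).
Variables (mu : {measure set T -> \bar R}) (D : set T).
Implicit Types (w : T -> R) (phi : nat -> T -> R) (c : nat -> R).

Definition mutually_orthogonal w phi := forall i j, i <> j ->
  (\int[mu]_(x in D) (phi i x * phi j x * (1 / w x))%:E = 0)%E.

Definition fourier_coef w phi (n : nat) : R :=
  (\int[mu]_(x in D) phi n x) / (\int[mu]_(x in D) (phi n x ^+ 2 / w x)).

(* w = \sum_n c n * phi n in mean square for the weight 1/w; sequences are
   indexed from 0, so the partial sum of order N runs over n < N *)
Definition mean_square_expansion w c phi :=
  (\int[mu]_(x in D) ((w x - \sum_(n < N) c n * phi n x) ^+ 2 * (1 / w x))%:E)%E
    @[N --> \oo] --> 0%E.

End fourier.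

(* Main.v *)
Require Import Defs.
From mathcomp Require Import measurable_realfun ring lra.

Import Order.TTheory GRing.Theory Num.Theory.
Import numFieldNormedType.Exports.

Local Open Scope classical_set_scope.
Local Open Scope ring_scope.

(** Let [S_N] and [U_N] be the partial sums of the expansions of [f] and [g].
The covariance form [cov u v = \int (u * v) - (\int u) * (\int v)] is bilinear,
so [cov S_N U_N] is the sum over [n, m < N] of the terms
[c n * d m * cov (phi n) (psi m)], and each of these is nonnegative by the
correlation hypothesis ([covariance_lincomb_ge0]). It remains to let [N] tend to
infinity.

The expansions converge in L2 for the weights [1 / f] and [1 / g]. If
[0 < w <= M] then [1 / w >= 1 / M], so convergence for the weight [1 / w] implies
plain L2 convergence ([weighted_mean_square_cvg]).
Since [D] is bounded it has finite measure, and L2 convergence implies L1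
convergence ([mean_square_cvg_L1]); hence [\int S_N] and [\int U_N] tend to
[\int f] and [\int g]. With [a = f - S_N] and [b = g - U_N],
[f * g - S_N * U_N = a * g + f * b - a * b], and each of these three terms tends
to 0 in L1 because [f] and [g] are bounded; hence [\int (S_N * U_N)] tends to
[\int (f * g)] ([cvg_RintegralM_mean_square]). So [cov f g] is a limit of
nonnegative numbers ([covariance_ge0]).

Apart from the weighted integrands, all the functions involved are bounded and
measurable on a set of finite measure, hence integrable: the argument runs on
real-valued integrals, and extended reals only appear where the weights do and in
reading the hypotheses. *)

(** * Bounded measurable functions on a set of finite measure *)

Section bounded_measurable.
Set Implicit Arguments.
Unset Strict Implicit.
Context d (T : measurableType d) (R : realType) (D : set T).
Hypothesis mD : measurable D.
Implicit Types u v w : T -> R.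

(** The bound is a single explicit constant, not a filter statement, so that
closure under the ring operations is immediate. *)
Definition bounded_measurable u :=
  measurable_fun D u /\ exists M, forall x, D x -> `|u x| <= M.

Lemma bounded_measurableP u : measurable_fun D u -> [bounded u x | x in D] ->
  bounded_measurable u.
Proof. by move=> mu /pinfty_ex_gt0[M _ uM]; split => //; exists M. Qed.

Lemma bounded_measurable_cst r : bounded_measurable (fun=> r).
Proof. by split; [exact: measurable_cst|exists `|r|]. Qed.

Lemma bounded_measurableD u v : bounded_measurable u -> bounded_measurable v ->
  bounded_measurable (fun x => u x + v x).
Proof.
move=> [mu [M uM]] [mv [N vN]]; split; first exact: measurable_funD.
by exists (M + N) => x Dx; rewrite (le_trans (ler_normD _ _))// lerD ?uM ?vN.
Qed.

Lemma bounded_measurableM u v : bounded_measurable u -> bounded_measurable v ->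
  bounded_measurable (fun x => u x * v x).
Proof.
move=> [mu [M uM]] [mv [N vN]]; split; first exact: measurable_funM.
by exists (M * N) => x Dx; rewrite normrM ler_pM ?uM ?vN.
Qed.

Lemma bounded_measurableB u v : bounded_measurable u -> bounded_measurable v ->
  bounded_measurable (fun x => u x - v x).
Proof.
move=> [mu [M uM]] [mv [N vN]]; split; first exact: measurable_funB.
by exists (M + N) => x Dx; rewrite (le_trans (ler_normB _ _))// lerD ?uM ?vN.
Qed.

Lemma bounded_measurable_norm u : bounded_measurable u ->
  bounded_measurable (fun x => `|u x|).
Proof.
move=> [mu [M uM]]; split; first exact: measurableT_comp.
by exists M => x Dx; rewrite normr_id uM.
Qed.

Lemma bounded_measurable_sum N (c : nat -> R) (phi : nat -> T -> R) :
  (forall n, bounded_measurable (phi n)) ->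
  bounded_measurable (fun x => \sum_(n < N) c n * phi n x).
Proof.
move=> bphi; elim: N => [|N IHN].
  under eq_fun do rewrite big_ord0; exact: bounded_measurable_cst.
under eq_fun do rewrite big_ord_recr/=.
apply: bounded_measurableD => //.
by apply: bounded_measurableM => //; exact: bounded_measurable_cst.
Qed.

(** Inversion agrees on positive reals with the real power of exponent [-1], which
is a measurable function on the whole line. *)
Lemma measurable_fun_pos_inv w : (forall x, D x -> 0 < w x) ->
  measurable_fun D w -> measurable_fun D (fun x => (w x)^-1).
Proof.
move=> w0 mw; apply: (eq_measurable_fun (fun x => w x `^ (-1))).
  by move=> x /[!inE] Dx; rewrite powR_inv1// ltW// w0.
exact: (measurableT_comp (f := fun x => powR x (-1))
  (measurable_powR (-1)) mw).
Qed.

Variable mu : {measure set T -> \bar R}.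
Hypothesis muD : (mu D < +oo)%E.

Lemma bounded_measurable_integrable u :
  bounded_measurable u -> mu.-integrable D (EFin \o u).
Proof.
move=> [mfu [M uM]]; apply: measurable_bounded_integrable => //.
exists M; split; first exact: num_real.
by move=> N MN x Dx; exact: le_trans (uM _ Dx) (ltW MN).
Qed.

Lemma Rintegral_lincomb N (c : nat -> R) (phi : nat -> T -> R) :
  (forall n, bounded_measurable (phi n)) ->
  \int[mu]_(x in D) (\sum_(n < N) c n * phi n x) =
  \sum_(n < N) c n * \int[mu]_(x in D) phi n x.
Proof.
move=> bphi; elim: N => [|N IHN].
  rewrite big_ord0; under eq_Rintegral do rewrite big_ord0.
  by rewrite Rintegral_cst// mul0r.
rewrite big_ord_recr/= -IHN; under eq_Rintegral do rewrite big_ord_recr/=.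
rewrite RintegralD//; last 2 first.
- exact/bounded_measurable_integrable/bounded_measurable_sum.
- apply/bounded_measurable_integrable/bounded_measurableM => //.
  exact: bounded_measurable_cst.
by rewrite RintegralZl//; exact: bounded_measurable_integrable.
Qed.

(** * Convergence of integrals *)

(** If [w <= M] then [u n x ^+ 2 <= M * (u n x ^+ 2 / w x)]. The comparison is made
on extended integrals, because [1 / w] may be unbounded and the weighted integrals
may be infinite for some [n]. *)
Lemma weighted_mean_square_cvg w (u : nat -> T -> R) :
  bounded_measurable w -> (forall x, D x -> 0 < w x) ->
  (forall n, bounded_measurable (u n)) ->
  (\int[mu]_(x in D) (u n x ^+ 2 * (1 / w x))%:E)%E @[n --> \oo] --> 0%E ->
  \int[mu]_(x in D) (u n x ^+ 2) @[n --> \oo] --> 0.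
Proof.
move=> [mw [M wM]] w0 bu cu.
have mw' n : measurable_fun D (fun x => (u n x ^+ 2 * (1 / w x))%:E).
  apply/measurable_EFinP/measurable_funM.
    by apply: measurable_funX; exact: (bu n).1.
  under eq_fun do rewrite div1r; exact: measurable_fun_pos_inv.
have w1 n x : D x -> (0 <= (u n x ^+ 2 * (1 / w x))%:E)%E.
  by move=> Dx; rewrite lee_fin mulr_ge0 ?sqr_ge0// divr_ge0// ltW// w0.
suff: (\int[mu]_(x in D) (u n x ^+ 2)%:E)%E @[n --> \oo] --> 0%E.
  by move=> /fine_cvg.
apply: (@squeeze_cvge _ _ _ _ (cst 0%E) _
    (fun n => `|M|%:E * \int[mu]_(x in D) (u n x ^+ 2 * (1 / w x))%:E)%E).
- near=> n; apply/andP; split.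
    by apply: integral_ge0 => x _; rewrite lee_fin sqr_ge0.
  rewrite -ge0_integralZl_EFin//; last exact: w1.
  apply: ge0_le_integral => //.
  + by move=> x _; rewrite lee_fin sqr_ge0.
  + by apply/measurable_EFinP/measurable_funX; exact: (bu n).1.
  + exact: measurable_funeM.
  move=> x Dx; rewrite -EFinM lee_fin mulrCA ler_peMr ?sqr_ge0// div1r.
  rewrite -ler_pdivrMr ?invr_gt0 ?w0// invrK mul1r.
  rewrite (le_trans (ler_norm _))// (le_trans (wM _ Dx))//; exact: ler_norm.
- exact: cvg_cst.
- by rewrite -(mule0 `|M|%:E); exact: cvgeZl.
Unshelve. all: by end_near. Qed.

(** For every [t > 0], [|u| <= t + u ^ 2 / t], so the L1 norm is at most
[t * mu D] plus a quantity that tends to 0; this takes the place of the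
Cauchy-Schwarz inequality. *)
Lemma mean_square_cvg_L1 (u : nat -> T -> R) :
  (forall n, bounded_measurable (u n)) ->
  \int[mu]_(x in D) (u n x ^+ 2) @[n --> \oo] --> 0 ->
  \int[mu]_(x in D) `|u n x| @[n --> \oo] --> 0.
Proof.
move=> bu cu; apply/cvgrPdist_le => e e0.
set m := fine (mu D).
have m0 : 0 <= m by exact: fine_ge0.
(* The choice of [t] makes [t * m <= e / 2]; [m + 1] avoids dividing by 0. *)
pose t := e / (2 * (m + 1)).
have t0 : 0 < t by rewrite divr_gt0// mulr_gt0// ltr_wpDl.
have te0 : 0 < t * (e / 2) by rewrite mulr_gt0// divr_gt0.
move/cvgrPdist_le : cu => /(_ _ te0) cu.
near=> n.
have : `|0 - \int[mu]_(x in D) (u n x ^+ 2)| <= t * (e / 2) by near: n.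
rewrite !sub0r !normrN ger0_norm ?Rintegral_ge0//;
  last by move=> x _; exact: sqr_ge0.
move=> le2.
rewrite ger0_norm ?Rintegral_ge0//.
have bu2 : bounded_measurable (fun x => u n x ^+ 2).
  by under eq_fun do rewrite expr2; exact: bounded_measurableM.
apply: (@le_trans _ _ (\int[mu]_(x in D) (t + t^-1 * u n x ^+ 2))).
  apply: le_Rintegral => //.
  - exact/bounded_measurable_integrable/bounded_measurable_norm.
  - apply/bounded_measurable_integrable/bounded_measurableD.
      exact: bounded_measurable_cst.
    by apply: bounded_measurableM => //; exact: bounded_measurable_cst.
  move=> x _; rewrite -(ler_pM2l t0) mulrDr mulVKf ?gt_eqF//.
  rewrite -(real_normK (num_real (u n x))).
  have := normr_ge0 (u n x); nra.
rewrite RintegralD//; last 2 first.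
- exact/bounded_measurable_integrable/bounded_measurable_cst.
- apply/bounded_measurable_integrable/bounded_measurableM => //.
  exact: bounded_measurable_cst.
rewrite Rintegral_cst// RintegralZl//; last exact: bounded_measurable_integrable.
rewrite (splitr e) lerD//.
  have te : t * (2 * (m + 1)) = e.
    by rewrite mulfVK// gt_eqF// mulr_gt0// ltr_wpDl.
  rewrite -/m -te; nra.
by rewrite -(ler_pM2l t0) mulVKf ?gt_eqF.
Unshelve. all: by end_near. Qed.

Lemma cvg_Rintegral_of_bound (v b : nat -> T -> R) h :
  bounded_measurable h -> (forall n, bounded_measurable (v n)) ->
  (forall n, bounded_measurable (b n)) ->
  (forall n x, D x -> `|h x - v n x| <= b n x) ->
  \int[mu]_(x in D) b n x @[n --> \oo] --> 0 ->
  \int[mu]_(x in D) v n x @[n --> \oo] --> \int[mu]_(x in D) h x.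
Proof.
move=> bh bv bb vb cb; apply/cvgrPdist_le => e e0.
move/cvgrPdist_le : cb => /(_ _ e0); apply: filterS => n.
rewrite sub0r normrN => /(le_trans (ler_norm _)); apply: le_trans.
rewrite -RintegralB//; do ?exact: bounded_measurable_integrable.
have bd := bounded_measurableB bh (bv n).
apply: le_trans; first exact/le_normr_Rintegral/bounded_measurable_integrable.
apply: le_Rintegral => //; last exact: vb.
- exact/bounded_measurable_integrable/bounded_measurable_norm.
- exact: bounded_measurable_integrable.
Qed.

End bounded_measurable.

Section covariance.
Set Implicit Arguments.
Unset Strict Implicit.
Context d (T : measurableType d) (R : realType) (D : set T).
Variable mu : {measure set T -> \bar R}.
Hypotheses (mD : measurable D) (muD : (mu D < +oo)%E).

Lemma cvg_Rintegral_mean_square (u : nat -> T -> R) f :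
  bounded_measurable D f -> (forall n, bounded_measurable D (u n)) ->
  \int[mu]_(x in D) ((f x - u n x) ^+ 2) @[n --> \oo] --> 0 ->
  \int[mu]_(x in D) u n x @[n --> \oo] --> \int[mu]_(x in D) f x.
Proof.
move=> bf bu cu.
have bfu n := bounded_measurableB bf (bu n).
apply: (cvg_Rintegral_of_bound mD muD (b := fun n x => `|f x - u n x|)) => //.
  by move=> n; exact: bounded_measurable_norm.
exact: mean_square_cvg_L1.
Qed.

(** The pointwise bound is [N * |a| + M * |b| + a ^ 2 + b ^ 2], where [a] and [b] are
the errors on the two factors, [|f| <= M], [|g| <= N]: the product [a * b] of the
errors is absorbed by the two squares, which keeps the sup norms of [u n] and
[v n], unbounded in [n] in general, out of the estimate. *)
Lemma cvg_RintegralM_mean_square (u v : nat -> T -> R) f g :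
  bounded_measurable D f -> bounded_measurable D g ->
  (forall n, bounded_measurable D (u n)) ->
  (forall n, bounded_measurable D (v n)) ->
  \int[mu]_(x in D) ((f x - u n x) ^+ 2) @[n --> \oo] --> 0 ->
  \int[mu]_(x in D) ((g x - v n x) ^+ 2) @[n --> \oo] --> 0 ->
  \int[mu]_(x in D) (u n x * v n x) @[n --> \oo] -->
  \int[mu]_(x in D) (f x * g x).
Proof.
move=> bf bg bu bv cu cv.
have [_ [M fM]] := bf; have [_ [N gN]] := bg.
have bfu n := bounded_measurableB bf (bu n).
have bgv n := bounded_measurableB bg (bv n).
have bn w : bounded_measurable D w -> bounded_measurable D (fun x => `|w x|).
  exact: bounded_measurable_norm.
have b2 w : bounded_measurable D w -> bounded_measurable D (fun x => w x ^+ 2).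
  by move=> bw; under eq_fun do rewrite expr2; exact: bounded_measurableM.
have bc r w : bounded_measurable D w -> bounded_measurable D (fun x => r * w x).
  by move=> bw; apply: bounded_measurableM => //; exact: bounded_measurable_cst.
have bD w1 w2 := @bounded_measurableD _ _ _ _ w1 w2.
apply: (cvg_Rintegral_of_bound mD muD (b := fun n x =>
  (N * `|f x - u n x| + M * `|g x - v n x|) +
  ((f x - u n x) ^+ 2 + (g x - v n x) ^+ 2))).
- exact: bounded_measurableM.
- by move=> n; exact: bounded_measurableM.
- by move=> n; apply: (bD); apply: (bD);
    [exact/bc/bn|exact/bc/bn|exact: b2|exact: b2].
- move=> n x Dx.
  set a := f x - u n x; set b := g x - v n x.
  have -> : f x * g x - u n x * v n x = a * g x + f x * b - a * b.
    by rewrite /a /b; ring.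
  rewrite (le_trans (ler_normB _ _))//.
  rewrite (le_trans (lerD (ler_normD _ _) (lexx _)))//.
  rewrite !normrM -(real_normK (num_real a)) -(real_normK (num_real b)).
  have := ler_wpM2l (normr_ge0 a) (gN x Dx).
  have := ler_wpM2l (normr_ge0 b) (fM x Dx).
  have := normr_ge0 a; have := normr_ge0 b; nra.
- pose I w := \int[mu]_(x in D) w x.
  have intb n : I (fun x => (N * `|f x - u n x| + M * `|g x - v n x|) +
      ((f x - u n x) ^+ 2 + (g x - v n x) ^+ 2)) =
      (N * I (fun x => `|f x - u n x|) + M * I (fun x => `|g x - v n x|)) +
      (I (fun x => (f x - u n x) ^+ 2) + I (fun x => (g x - v n x) ^+ 2)).
    by rewrite /I !(RintegralD, RintegralZl)//;
      apply: (bounded_measurable_integrable mD muD); auto.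
  rewrite (eq_cvg _ _ intb).
  have cu1 := mean_square_cvg_L1 mD muD bfu cu.
  have cv1 := mean_square_cvg_L1 mD muD bgv cv.
  have := cvgD (cvgD (cvgM (cvg_cst N) cu1) (cvgM (cvg_cst M) cv1)) (cvgD cu cv).
  by rewrite !mulr0 !addr0; exact.
Qed.

(** * Positivity of the covariance *)

(** Both sides expand by bilinearity, and the hypothesis compares them term by
term; it cannot be divided by [c n * e m], whose sign is arbitrary. *)
Lemma covariance_lincomb_ge0 (c e : nat -> R) (phi psi : nat -> T -> R) N :
  (forall n, bounded_measurable D (phi n)) ->
  (forall n, bounded_measurable D (psi n)) ->
  (forall n m, c n * e m * (\int[mu]_(x in D) phi n x * \int[mu]_(x in D) psi m x)
    <= c n * e m * \int[mu]_(x in D) (phi n x * psi m x)) ->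
  (\int[mu]_(x in D) \sum_(n < N) c n * phi n x) *
  (\int[mu]_(x in D) \sum_(m < N) e m * psi m x) <=
  \int[mu]_(x in D) ((\sum_(n < N) c n * phi n x) * \sum_(m < N) e m * psi m x).
Proof.
move=> bphi bpsi h.
have bS := bounded_measurable_sum N e bpsi.
rewrite !Rintegral_lincomb//.
under [leRHS]eq_Rintegral => x _.
  rewrite mulr_suml; under eq_bigr do rewrite -mulrA.
  over.
rewrite (Rintegral_lincomb mD muD N c
  (phi := fun n x => phi n x * \sum_(m < N) e m * psi m x)); last first.
  by move=> n; exact: bounded_measurableM.
rewrite mulr_suml; apply: ler_sum => n _.
under [X in _ <= _ * X]eq_Rintegral => x _.
  rewrite mulr_sumr; under eq_bigr do rewrite mulrCA.
  over.
rewrite (Rintegral_lincomb mD muD N e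
  (phi := fun m x => phi n x * psi m x)); last first.
  by move=> m; exact: bounded_measurableM.
rewrite !mulr_sumr; apply: ler_sum => m _.
by rewrite mulrACA [leRHS]mulrA.
Qed.

(** The two sides of [covariance_lincomb_ge0], applied to the partial sums of order
[N], converge to the two sides of this inequality. *)
Lemma covariance_ge0 (f g : T -> R) (c e : nat -> R) (phi psi : nat -> T -> R) :
  bounded_measurable D f -> bounded_measurable D g ->
  (forall x, D x -> 0 < f x) -> (forall x, D x -> 0 < g x) ->
  (forall n, bounded_measurable D (phi n)) ->
  (forall n, bounded_measurable D (psi n)) ->
  mean_square_expansion mu D f c phi -> mean_square_expansion mu D g e psi ->
  (forall n m, c n * e m * (\int[mu]_(x in D) phi n x * \int[mu]_(x in D) psi m x)
    <= c n * e m * \int[mu]_(x in D) (phi n x * psi m x)) ->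
  (\int[mu]_(x in D) f x) * (\int[mu]_(x in D) g x) <=
  \int[mu]_(x in D) (f x * g x).
Proof.
move=> bf bg f0 g0 bphi bpsi ef eg h.
pose S N x := \sum_(n < N) c n * phi n x.
pose U N x := \sum_(m < N) e m * psi m x.
have bS N : bounded_measurable D (S N) by exact: bounded_measurable_sum.
have bU N : bounded_measurable D (U N) by exact: bounded_measurable_sum.
have cS : \int[mu]_(x in D) ((f x - S n x) ^+ 2) @[n --> \oo] --> 0.
  apply: (weighted_mean_square_cvg mD (mu := mu)
    (u := fun n x => f x - S n x)) ef => // n.
  exact: bounded_measurableB.
have cU : \int[mu]_(x in D) ((g x - U n x) ^+ 2) @[n --> \oo] --> 0.
  apply: (weighted_mean_square_cvg mD (mu := mu)
    (u := fun n x => g x - U n x)) eg => // n.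
  exact: bounded_measurableB.
have cf := cvg_Rintegral_mean_square bf bS cS.
have cg := cvg_Rintegral_mean_square bg bU cU.
have cfg := cvg_RintegralM_mean_square bf bg bS bU cS cU.
apply: (ler_cvg_to (cvgM cf cg) cfg).
by apply: nearW => N; exact: (covariance_lincomb_ge0 N bphi bpsi h).
Qed.

End covariance.

(** * Bounded sets have finite Lebesgue outer measure *)

(** A set in the ball of radius [M] for the sup norm is covered by a single box. *)
Lemma bounded_set_lebesgue_lty (R : realType) (p : nat) (D : set 'rV[R]_p) :
  bounded_set D -> (lebesgue_outer D < +oo)%E.
Proof.
move=> /pinfty_ex_gt0[M M0 DM].
(* Boxes are open at their lower corner, hence the margin of 1 on that side. *)
pose a : 'rV[R]_p := \row_(i < p) (- (M + 1)).
pose b : 'rV[R]_p := \row_(i < p) M.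
apply: (@le_lt_trans _ _ (box_volume a b)%:E); last exact: ltry.
apply: ereal_inf_lbound; exists [set 0%N], (fun=> a), (fun=> b); split.
  move=> x Dx; exists 0%N => // i; rewrite !mxE.
  have xM : `|x ord0 i| <= M.
    apply: le_trans (DM x Dx); rewrite [leRHS]/Num.Def.normr/= mx_normrE.
    exact: (le_bigmax _ (fun ij => `|x ij.1 ij.2|) (ord0, i)).
  move: xM; rewrite ler_norml => /andP[xl xr]; rewrite xr andbT.
  by rewrite (lt_le_trans _ xl)// ltrN2 ltrDl.
by rewrite esum_set1// box_volume_ge0.
Qed.

(** * The covariance inequality for functions with Fourier expansions *)

Theorem theorem4p1 (R : realType) (p : nat) (D : set (lebesgueType R p))
    (f g : lebesgueType R p -> R) (phi psi : nat -> lebesgueType R p -> R)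
    (c := fourier_coef lebesgue_rV D f phi) (d := fourier_coef lebesgue_rV D g psi)
    (bD : bounded_set (D : set 'rV[R]_p)) (mD : measurable D)
    (bf : [bounded f x | x in D]) (bg : [bounded g x | x in D])
    (f0 : forall x, D x -> 0 < f x) (g0 : forall x, D x -> 0 < g x)
    (mf : measurable_fun D f) (mg : measurable_fun D g)
    (bphi : forall n, [bounded phi n x | x in D])
    (bpsi : forall m, [bounded psi m x | x in D])
    (mphi : forall n, measurable_fun D (phi n))
    (mpsi : forall m, measurable_fun D (psi m))
    (ophi : mutually_orthogonal lebesgue_rV D f phi)
    (opsi : mutually_orthogonal lebesgue_rV D g psi)
    (nphi : forall n, (0 < \int[lebesgue_rV]_(x in D) (phi n x ^+ 2 / f x)%:E < +oo)%E)
    (npsi : forall m, (0 < \int[lebesgue_rV]_(x in D) (psi m x ^+ 2 / g x)%:E < +oo)%E)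
    (ef : mean_square_expansion lebesgue_rV D f c phi)
    (eg : mean_square_expansion lebesgue_rV D g d psi)
    (hprod : forall n m,
      (\int[lebesgue_rV]_(x in D) (phi n x ^+ 2 * psi m x ^+ 2 / (f x * g x))%:E <=
       \int[lebesgue_rV]_(x in D) (phi n x ^+ 2 / f x)%:E *
       \int[lebesgue_rV]_(x in D) (psi m x ^+ 2 / g x)%:E)%E)
    (hcorr : forall n m,
      ((c n * d m)%:E * \int[lebesgue_rV]_(x in D) (phi n x * psi m x)%:E >=
       (c n * d m)%:E * (\int[lebesgue_rV]_(x in D) (phi n x)%:E *
                         \int[lebesgue_rV]_(x in D) (psi m x)%:E))%E) :
  (\int[lebesgue_rV]_(x in D) (f x * g x)%:E >=
   \int[lebesgue_rV]_(x in D) (f x)%:E * \int[lebesgue_rV]_(x in D) (g x)%:E)%E.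
Proof.
have muD : (lebesgue_rV D < +oo)%E by exact: bounded_set_lebesgue_lty.
have Bf : bounded_measurable D f by exact: bounded_measurableP.
have Bg : bounded_measurable D g by exact: bounded_measurableP.
have Bphi n : bounded_measurable D (phi n) by exact: bounded_measurableP.
have Bpsi n : bounded_measurable D (psi n) by exact: bounded_measurableP.
have intE u : bounded_measurable D u -> (\int[lebesgue_rV]_(x in D) (u x)%:E =
    (\int[lebesgue_rV]_(x in D) u x)%R%:E)%E.
  by move=> Bu; rewrite fineK// integrable_fin_num//;
    exact: bounded_measurable_integrable.
rewrite !intE//; last exact: bounded_measurableM.
rewrite -EFinM lee_fin.
apply: (covariance_ge0 mD muD (c := c) (e := d) (phi := phi) (psi := psi)) => // n m.
rewrite -lee_fin; have := hcorr n m.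
by rewrite !intE//; exact: bounded_measurableM.
Qed.
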